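(* Suppose that $I\subseteq\Psi_L$ is an ideal generated by homogeneous polynomials $f_1,\dots,f_k\in\operatorname{Sym}L$ together with their exterior derivatives $df_1,\dots,df_k\in\Psi_L$. Then $dI\subseteq I$ and $\iota_{\mathcal{E}}I\subseteq I$. Moreover, the derivative $d:\Psi_L/I\to\Psi_L/I$ is exact except in degree $(0,0)$.
   Context: $L$ is a complex vector space with basis $e_1,\dots,e_r$. $\Psi_L=\operatorname{Sym}L\otimes\wedge^\bullet L$ is the superspace ring (polynomial differential forms on $L^*$), bigraded by (commutative degree, anticommutative degree); write $v=v\otimes1$ and $dv=1\otimes v$ for $v\in L$. $d:\Psi_L\to\Psi_L$ is the exterior derivative, of bidegree $(-1,1)$: $d\big(f(e_1,\dots,e_r)\,de_{i_1}\cdots de_{i_m}\big)=\sum_{j}\frac{\partial f}{\partial e_j}\,de_j\,de_{i_1}\cdots de_{i_m}$. $\iota_{\mathcal{E}}:\Psi_L\to\Psi_L$ is contraction with the Euler vector field $\sum_i e_i\,\partial/\partial e_i$ on $L^*$, of bidegree $(1,-1)$: it is the $\operatorname{Sym}L$-linear antiderivation with $\iota_{\mathcal{E}}(de_i)=e_i$. Exact in degree $(a,b)$ means that the kernel of $d$ on $(\Psi_L/I)^{a,b}$ equals the image of $d$ from $(\Psi_L/I)^{a+1,b-1}$. *)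

(* Defs.v *)
From HB Require Import structures.
From mathcomp Require Import all_boot all_order all_algebra.
From mathcomp Require Import boolp reals complex.
From mathcomp Require Import mpoly.
From mathcomp Require Import ring.

Set Implicit Arguments.
Unset Strict Implicit.
Unset Printing Implicit Defensive.

Import GRing.Theory.
Local Open Scope ring_scope.

(* With e_1, ..., e_r a basis of L, Sym L is {mpoly K[r]} (e_i being 'X_i), and *)
(* the wedge monomials de_S := de_{i_1} ... de_{i_m}, S = {i_1 < ... < i_m},    *)
(* are a Sym L-basis of Sym L (x) /\L: u stands for the sum of the (u S) de_S.  *)
Definition superspace (K : comNzRingType) (r : nat) : Type :=
  {ffun {set 'I_r} -> {mpoly K[r]}}.

HB.instance Definition _ (K : comNzRingType) (r : nat) :=
  GRing.Zmodule.copy (superspace K r) {ffun {set 'I_r} -> {mpoly K[r]}}.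

(* For disjoint S and T, de_S de_T = (-1) ^+ ninv S T de_(S :|: T). *)
Definition ninv (r : nat) (S T : {set 'I_r}) : nat :=
  (\sum_(i in S) \sum_(j in T) (j < i))%N.

Section Ring.
Variables (K : comNzRingType) (r : nat).
Implicit Types (u v w : superspace K r) (S T U : {set 'I_r}) (p q : {mpoly K[r]}).

(* p de_S *)
Definition sp_term p S : superspace K r :=
  [ffun T : {set 'I_r} => if T == S then p else 0].

Definition sp_one : superspace K r := sp_term 1 set0.

Definition sp_mul u v : superspace K r :=
  [ffun S : {set 'I_r} => \sum_(T : {set 'I_r} | T \subset S)
     (-1) ^+ ninv T (S :\: T) * (u T * v (S :\: T))].

Lemma ninv0S S : ninv set0 S = 0%N.
Proof. by rewrite /ninv big_set0. Qed.

Lemma ninvS0 S : ninv S set0 = 0%N.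
Proof. by rewrite /ninv big1 // => i _; rewrite big_set0. Qed.

Lemma sum_disjU S T (F : 'I_r -> nat) : [disjoint S & T] ->
  (\sum_(i in S :|: T) F i = \sum_(i in S) F i + \sum_(i in T) F i)%N.
Proof.
move=> dST; rewrite -bigU //; apply: eq_bigl => i.
by rewrite in_setU inE.
Qed.

Lemma ninvUl S T U :
  [disjoint S & T] -> ninv (S :|: T) U = (ninv S U + ninv T U)%N.
Proof. exact: sum_disjU. Qed.

Lemma ninvUr S T U :
  [disjoint T & U] -> ninv S (T :|: U) = (ninv S T + ninv S U)%N.
Proof.
move=> dTU; rewrite /ninv -big_split /=.
by apply: eq_bigr => i _; exact: sum_disjU.
Qed.

Lemma setUD_id S T : S \subset T -> S :|: (T :\: S) = T.
Proof. by move=> ST; rewrite -{1}(setIidPr ST) setID. Qed.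

Fact sp_mulA : associative sp_mul.
Proof.
move=> u v w; apply/ffunP => S; rewrite !ffunE.
under eq_bigr => P _ do rewrite ffunE mulr_sumr mulr_sumr.
under [RHS]eq_bigr => T _ do rewrite ffunE mulr_suml mulr_sumr.
rewrite [RHS](exchange_big_dep (fun P : {set 'I_r} => P \subset S)) /=; last first.
  by move=> T P TS PT; apply: subset_trans PT TS.
apply: eq_bigr => P PS.
rewrite (reindex_onto (fun T => T :\: P) (fun Q => P :|: Q)) /=; last first.
  move=> Q; rewrite subsetD => /andP[_ dQ]; rewrite setDUl setDv set0U.
  exact/setDidPl.
have setDK T := @setUD_id P T.
have eqc T : (T :\: P \subset S :\: P) && (P :|: (T :\: P) == T) =
    (T \subset S) && (P \subset T).
  apply/andP/andP => [[+ /eqP eT]|[TS PT]].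
    rewrite subsetD => /andP[sTS _].
    have PT : P \subset T by rewrite -eT subsetUl.
    by split=> //; rewrite -eT subUset PS.
  by rewrite setSD // setDK.
apply: eq_big => [T|T]; first exact: eqc.
rewrite eqc => /andP[TS PT]; have eT := setDK T PT.
have eD : S :\: P :\: (T :\: P) = S :\: T by rewrite setDDl eT.
rewrite eD.
have dP : [disjoint P & T :\: P].
  by rewrite -setI_eq0 setIDA setIC -setIDA setDv setI0.
have dT : [disjoint T :\: P & S :\: T].
  rewrite -setI_eq0 -subset0; apply/subsetP => i; rewrite !inE.
  by case: (i \in T); rewrite ?andbF.
have eS : S :\: P = (T :\: P) :|: (S :\: T).
  apply/setP => i; rewrite !inE; have := subsetP TS i; have := subsetP PT i.
  by case: (i \in P); case: (i \in T); case: (i \in S) => //= h1 h2;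
     first [by have := h1 isT | by have := h2 isT].
have -> : ninv P (S :\: P) = (ninv P (T :\: P) + ninv P (S :\: T))%N.
  by rewrite eS ninvUr.
have -> : ninv T (S :\: T) = (ninv P (S :\: T) + ninv (T :\: P) (S :\: T))%N.
  by rewrite -ninvUl // eT.
rewrite !exprD; ring.
Qed.

Lemma sp_termM p q S T : sp_mul (sp_term p S) (sp_term q T) =
  if [disjoint S & T] then sp_term ((-1) ^+ ninv S T * (p * q)) (S :|: T) else 0.
Proof.
apply/ffunP => U; rewrite !ffunE (fun_if (fun f : superspace K r => f U)) !ffunE.
have [dST|ndST] := boolP [disjoint S & T]; last first.
  apply: big1 => V VU; rewrite !ffunE; case: eqP => [->|_]; last by rewrite mul0r mulr0.
  case: eqP => [e|_]; last by rewrite !mulr0.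
  case/negP: ndST; rewrite -e -setI_eq0 setIDA setIC -setIDA setDv setI0.
  exact: eqxx.
have [->|neU] := eqVneq U (S :|: T).
  rewrite (bigD1 S) ?subsetUl //= [X in _ + X]big1 => [|V /andP[_ nV]].
    have -> : (S :|: T) :\: S = T.
      by rewrite setDUl setDv set0U; apply/setDidPl; rewrite disjoint_sym.
    by rewrite !ffunE !eqxx addr0.
  by rewrite ffunE (negPf nV) mul0r mulr0.
apply: big1 => V VU; rewrite !ffunE; case: eqP => [eV|_]; last by rewrite mul0r mulr0.
case: eqP => [e|_]; last by rewrite !mulr0.
by case/negP: neU; rewrite -e eV setUD_id // -eV.
Qed.

Fact sp_mul1l : left_id sp_one sp_mul.
Proof.
move=> u; apply/ffunP => S; rewrite ffunE (bigD1 set0) ?sub0set //= big1.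
  by rewrite ninv0S ffunE eqxx setD0 !mul1r addr0.
by move=> T /andP[_ nT]; rewrite ffunE (negPf nT) mul0r mulr0.
Qed.

Fact sp_mul1r : right_id sp_one sp_mul.
Proof.
move=> u; apply/ffunP => S; rewrite ffunE (bigD1 S) //= big1.
  by rewrite setDv ninvS0 ffunE eqxx mul1r mulr1 addr0.
move=> T /andP[TS nT]; rewrite ffunE setD_eq0; case: ifP => [ST|_].
  by case/negP: nT; rewrite eqEsubset TS ST.
by rewrite !mulr0.
Qed.

Fact sp_mulDl : left_distributive sp_mul +%R.
Proof.
move=> u v w; apply/ffunP => S; rewrite !ffunE -big_split /=.
by apply: eq_bigr => T _; rewrite !ffunE mulrDl mulrDr.
Qed.

Fact sp_mulDr : right_distributive sp_mul +%R.
Proof.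
move=> u v w; apply/ffunP => S; rewrite !ffunE -big_split /=.
by apply: eq_bigr => T _; rewrite !ffunE !mulrDr.
Qed.

Fact sp_oner_neq0 : sp_one != 0.
Proof.
apply/eqP => /ffunP /(_ set0); rewrite !ffunE eqxx => /eqP.
by rewrite oner_eq0.
Qed.

HB.instance Definition _ := GRing.Zmodule_isNzRing.Build (superspace K r)
  sp_mulA sp_mul1l sp_mul1r sp_mulDl sp_mulDr sp_oner_neq0.

(* f (x) 1, de_i = 1 (x) e_i and de_S *)
Definition sp_poly p : superspace K r := sp_term p set0.
Definition dvar (i : 'I_r) : superspace K r := sp_term 1 [set i].
Definition dmon S : superspace K r := sp_term 1 S.

Definition ext_deriv u : superspace K r :=
  \sum_(S : {set 'I_r}) \sum_(j < r) sp_poly (u S)^`M(j) * (dvar j * dmon S).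

(* f de_{i_1} ... de_{i_m} |->                                               *)
(*   \sum_k (-1)^(k-1) e_{i_k} f de_{i_1} .. omit de_{i_k} .. de_{i_m}       *)
Definition euler_contract u : superspace K r :=
  \sum_(S : {set 'I_r}) \sum_(i in S)
    (-1) ^+ #|[set j in S | (j < i)%N]| * (sp_poly ('X_i * u S) * dmon (S :\ i)).

(* bidegree a b u: u lies in the (a, b) piece, which is 0 if a < 0 or b < 0 *)
Definition bidegree (a b : int) u : Prop :=
  forall S (m : 'X_{1..r}), (u S)@_m != 0 -> (mdeg m)%:Z = a /\ #|S|%:Z = b.

Lemma sp_mulE u v : u * v = sp_mul u v. Proof. by []. Qed.

Lemma sp_polyMl p u S : (sp_poly p * u) S = p * u S.
Proof.
rewrite ffunE (bigD1 set0) ?sub0set //= big1 => [|T /andP[_ nT]].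
  by rewrite ninv0S setD0 ffunE eqxx mul1r addr0.
by rewrite ffunE (negPf nT) mul0r mulr0.
Qed.

Lemma sp_polyMr p u S : (u * sp_poly p) S = u S * p.
Proof.
rewrite ffunE (bigD1 S) //= big1 => [|T /andP[TS nT]].
  by rewrite setDv ninvS0 ffunE eqxx mul1r addr0.
rewrite ffunE setD_eq0; case: ifP => [ST|_]; last by rewrite !mulr0.
by case/negP: nT; rewrite eqEsubset TS ST.
Qed.

Lemma sp_polyC p u : sp_poly p * u = u * sp_poly p.
Proof. by apply/ffunP => S; rewrite sp_polyMl sp_polyMr mulrC. Qed.

Lemma sp_poly_dmon p S : sp_poly p * dmon S = sp_term p S.
Proof.
by apply/ffunP => T; rewrite sp_polyMl !ffunE; case: ifP; rewrite ?mulr1 ?mulr0.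
Qed.

Lemma sp_polyM p q : sp_poly (p * q) = sp_poly p * sp_poly q.
Proof.
by apply/ffunP => T; rewrite sp_polyMl !ffunE; case: ifP; rewrite ?mulr0.
Qed.

Lemma sp_poly0 : sp_poly 0 = 0.
Proof. by apply/ffunP => U; rewrite !ffunE if_same. Qed.

Lemma sp_poly1 : sp_poly 1 = 1.
Proof. by []. Qed.

Lemma sp_decomp u : u = \sum_S sp_poly (u S) * dmon S.
Proof.
apply/ffunP => T; rewrite sum_ffunE (bigD1 T) //= big1 => [|S nS].
  by rewrite sp_poly_dmon ffunE eqxx addr0.
by rewrite sp_poly_dmon ffunE eq_sym (negPf nS).
Qed.

Lemma sp_poly_sign n : sp_poly ((-1) ^+ n) = (-1) ^+ n.
Proof.
have N1 : sp_poly (-1) = -1.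
  by apply/ffunP => T; rewrite !ffunE; case: ifP; rewrite ?oppr0.
by elim: n => // n IH; rewrite !exprS sp_polyM IH N1.
Qed.

Lemma dvar_dmon i S : dvar i * dmon S =
  if i \in S then 0 else (-1) ^+ #|[set j in S | (j < i)%N]| * dmon (i |: S).
Proof.
rewrite sp_mulE sp_termM disjoints1 mulr1 mulr1.
case: (i \in S) => //=; rewrite /ninv big_set1.
rewrite -sp_poly_dmon sp_poly_sign; congr (_ ^+ _ * _).
rewrite -sum1dep_card [RHS]big_mkcondr /=; apply: eq_bigr => j _.
by case: (j < i)%N.
Qed.

Lemma dvar_sqr i : dvar i * dvar i = 0.
Proof. by rewrite {2}/dvar -/(dmon _) dvar_dmon set11. Qed.

Lemma dvar_dvar i j : dvar i * dvar j =
  if i == j then 0 else (-1) ^+ (j < i)%N * dmon [set i; j].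
Proof.
rewrite {2}/dvar -/(dmon _) dvar_dmon inE; case: eqP => // nij.
congr (_ ^+ _ * _); have [ji|nji] := boolP (j < i)%N.
  by apply/eqP/cards1P; exists j; apply/setP => k; rewrite !inE;
    case: eqP => // ->.
by apply: eq_card0 => k; rewrite !inE; case: eqP => // ->; apply/negbTE.
Qed.

Lemma dvar_anticomm i j : dvar i * dvar j = - (dvar j * dvar i).
Proof.
rewrite !dvar_dvar eq_sym setUC; have [_|nij] := eqVneq j i; first by rewrite oppr0.
case: (ltngtP i j) => [ij|ij|/val_inj eij] /=.
- by rewrite expr0 expr1 mul1r mulN1r opprK.
- by rewrite expr0 expr1 mul1r mulN1r.
- by rewrite eij eqxx in nij.
Qed.

Lemma dmonE S : dmon S = \prod_(i <- enum S) dvar i.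
Proof.
have: sorted (relpre (@nat_of_ord r) ltn) (enum S).
  rewrite {1}/enum_mem; apply: sorted_filter; first by move=> x y z; apply: ltn_trans.
  by rewrite -enumT -sorted_map val_enum_ord; apply: iota_ltn_sorted.
have eS : S = [set i in enum S] by apply/setP => i; rewrite inE mem_enum.
have tr : transitive (relpre (@nat_of_ord r) ltn) by move=> ? ? ?; apply: ltn_trans.
rewrite [in dmon S]eS; elim: (enum S) => [_|x s IH].
  have -> : [set i : 'I_r in [::]] = set0 by apply/setP => i; rewrite !inE.
  by rewrite big_nil.
rewrite /= (path_sortedE tr) => /andP[/allP xs /IH{}IH].
rewrite big_cons -IH dvar_dmon inE; case: ifP => [/xs /=|_]; first by rewrite ltnn.
rewrite eq_card0 ?mul1r => [|i]; last first.
  rewrite !inE; apply/negbTE/negP => /andP[/xs /= xi].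
  by move=> /(ltn_trans xi); rewrite ltnn.
by congr dmon; apply/setP => i; rewrite !inE.
Qed.

Lemma sp_polyB p q : sp_poly (p - q) = sp_poly p - sp_poly q.
Proof. by apply/ffunP => T; rewrite !ffunE; case: ifP; rewrite ?subr0. Qed.

Lemma spB u v S : (u - v) S = u S - v S.
Proof. by rewrite !ffunE. Qed.

Fact ext_deriv_is_zmod_morphism : zmod_morphism ext_deriv.
Proof.
move=> u v; rewrite /ext_deriv -sumrB; apply: eq_bigr => S _.
rewrite -sumrB; apply: eq_bigr => j _.
by rewrite spB mderivB sp_polyB mulrBl.
Qed.
HB.instance Definition _ := GRing.isZmodMorphism.Build
  (superspace K r) (superspace K r) ext_deriv ext_deriv_is_zmod_morphism.

Fact euler_contract_is_zmod_morphism : zmod_morphism euler_contract.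
Proof.
move=> u v; rewrite /euler_contract -sumrB; apply: eq_bigr => S _.
rewrite -sumrB; apply: eq_bigr => i _.
by rewrite spB mulrBr sp_polyB mulrBl mulrBr.
Qed.
HB.instance Definition _ := GRing.isZmodMorphism.Build
  (superspace K r) (superspace K r) euler_contract euler_contract_is_zmod_morphism.

Lemma ext_deriv_term p S :
  ext_deriv (sp_poly p * dmon S) =
  \sum_(j < r) sp_poly p^`M(j) * (dvar j * dmon S).
Proof.
rewrite sp_poly_dmon /ext_deriv (bigD1 S) //= [X in _ + X]big1 => [|T nT].
  by rewrite addr0; apply: eq_bigr => j _; rewrite ffunE eqxx.
apply: big1 => j _; rewrite ffunE (negPf nT) mderiv0.
by rewrite sp_poly0 mul0r.
Qed.

Lemma sp_polyCA p u v : u * (sp_poly p * v) = sp_poly p * (u * v).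
Proof. by rewrite mulrA -sp_polyC mulrA. Qed.

Lemma sp_signCA n u v : u * ((-1) ^+ n * v) = (-1) ^+ n * (u * v).
Proof. by rewrite -sp_poly_sign sp_polyCA. Qed.

Lemma prod_dvar (s : seq 'I_r) : \prod_(i <- s) dvar i = 0 \/
  exists n S, \prod_(i <- s) dvar i = (-1) ^+ n * dmon S.
Proof.
elim: s => [|i s [IH|[n [S IH]]]].
- by right; exists 0%N, set0; rewrite big_nil expr0 mul1r.
- by left; rewrite big_cons IH mulr0.
rewrite big_cons IH; have [iS|niS] := boolP (i \in S).
  by left; rewrite sp_signCA dvar_dmon iS mulr0.
right; exists (n + #|[set j in S | (j < i)%N]|)%N, (i |: S).
by rewrite sp_signCA dvar_dmon (negPf niS) exprD mulrA.
Qed.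

Lemma ext_derivE p (s : seq 'I_r) :
  ext_deriv (sp_poly p * \prod_(i <- s) dvar i) =
  \sum_(j < r) sp_poly p^`M(j) * (dvar j * \prod_(i <- s) dvar i).
Proof.
have [->|[n [S ->]]] := prod_dvar s.
  by rewrite mulr0 raddf0 big1 // => j _; rewrite !mulr0.
rewrite -signr_odd; case: (odd n); rewrite ?expr0 ?expr1 ?mulN1r ?mul1r.
  rewrite mulrN raddfN /= ext_deriv_term -sumrN.
  by apply: eq_bigr => j _; rewrite !mulrN.
exact: ext_deriv_term.
Qed.

Lemma euler_contractZ p u :
  euler_contract (sp_poly p * u) = sp_poly p * euler_contract u.
Proof.
rewrite /euler_contract mulr_sumr; apply: eq_bigr => S _.
rewrite mulr_sumr; apply: eq_bigr => i _.
by rewrite sp_polyMl mulrCA (sp_polyM p) sp_signCA -(mulrA (sp_poly p)).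
Qed.

Lemma euler_contract_dmon S : euler_contract (dmon S) =
  \sum_(i in S) (-1) ^+ #|[set j in S | (j < i)%N]| * (sp_poly 'X_i * dmon (S :\ i)).
Proof.
rewrite /euler_contract (bigD1 S) //= [X in _ + X]big1 => [|T nT].
  by rewrite addr0; apply: eq_bigr => j _; rewrite ffunE eqxx mulr1.
apply: big1 => j _; rewrite ffunE (negPf nT) mulr0.
by rewrite sp_poly0 mul0r mulr0.
Qed.

Lemma euler_contract_dvar i : euler_contract (dvar i) = sp_poly 'X_i.
Proof.
rewrite euler_contract_dmon big_set1 setDv eq_card0 => [|j].
  by rewrite mul1r [dmon _]sp_poly1 mulr1.
by rewrite !inE; case: eqP => // ->; rewrite ltnn.
Qed.

Lemma euler_contract_dvarM i v :
  euler_contract (dvar i * v) = sp_poly 'X_i * v - dvar i * euler_contract v.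
Proof.
suff H S : euler_contract (dvar i * dmon S) =
    sp_poly 'X_i * dmon S - dvar i * euler_contract (dmon S).
  rewrite [v]sp_decomp (raddf_sum euler_contract) !mulr_sumr (raddf_sum euler_contract) -sumrB.
  apply: eq_bigr => S _; rewrite /= (sp_polyCA (v S)) 2!euler_contractZ H mulrBr.
  by rewrite !(sp_polyCA (v S)).
have cardS1 T a b : a \in T ->
    #|[set j in T | (j < b)%N]| = ((a < b) + #|[set j in T :\ a | (j < b)%N]|)%N.
  move=> aT; rewrite (cardsD1 a) inE aT /=; congr (_ + _)%N; apply: eq_card => j.
  by rewrite !inE andbA.
rewrite dvar_dmon !euler_contract_dmon mulr_sumr; case: ifPn => iS.
  rewrite raddf0 (bigD1 i) //= big1 => [|j /andP[jS nji]].
    rewrite sp_signCA sp_polyCA dvar_dmon !inE eqxx /= setD1K // addr0.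
    rewrite (cardS1 _ i) // ltnn add0n (sp_signCA _ (sp_poly 'X_i)) mulrA -exprD addnn -signr_odd odd_double.
    by rewrite mul1r subrr.
  by rewrite sp_signCA sp_polyCA dvar_dmon !inE eq_sym nji iS /= !mulr0.
rewrite -{1}sp_poly_sign euler_contractZ sp_poly_sign euler_contract_dmon.
rewrite big_setU1 //= mulrDr; congr (_ + _).
  rewrite setU1K // (cardS1 (i |: S) i i) ?setU11 // ltnn add0n setU1K //.
  by rewrite mulrA -exprD addnn -signr_odd odd_double mul1r.
rewrite mulr_sumr -sumrN; apply: eq_bigr => j jS.
have nji : j != i by apply: contraNneq iS => <-.
rewrite (sp_signCA _ (dvar i)) (sp_polyCA _ (dvar i)) dvar_dmon !inE eq_sym.
rewrite (negPf nji) (negPf iS) /=.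
rewrite (cardS1 S j i) // (cardS1 (i |: S) i j) ?setU11 // setU1K //.
have -> : (i |: S) :\ j = i |: (S :\ j).
  by apply/setP => k; rewrite !inE; case: (k =P i) => // ->; rewrite eq_sym nji.
rewrite (sp_signCA _ (sp_poly 'X_j)) !exprD -!mulrA -mulNr.
have := nji; rewrite neq_ltn => /orP[] ij; rewrite ij ltnNge (ltnW ij) /=.
  by rewrite expr0 expr1 !mul1r mulN1r mulNr sp_signCA.
by rewrite expr0 expr1 !mul1r mulN1r mulrN mulNr sp_signCA.
Qed.

Lemma euler_contractM b u v : (forall S, u S != 0 -> #|S| = b) ->
  euler_contract (u * v) =
  euler_contract u * v + (-1) ^+ b * (u * euler_contract v).
Proof.
move=> ub; rewrite {1 2}[u]sp_decomp mulr_suml !(raddf_sum euler_contract) mulr_suml.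
rewrite [in X in _ + X](sp_decomp u) mulr_suml mulr_sumr -big_split /=.
apply: eq_bigr => S _; have [->|nz] := eqVneq (u S) 0.
  by rewrite sp_poly0 !(mul0r, mulr0, raddf0, add0r).
rewrite -(ub S nz) -!mulrA /= 2!euler_contractZ.
rewrite -sp_poly_sign [X in _ + X]mulrA -sp_polyM mulrC sp_polyM -!mulrA -mulrDr.
congr (_ * _); rewrite sp_poly_sign {ub nz}.
rewrite dmonE cardE; elim: (enum S) => [|i s IH].
  rewrite big_nil /= expr0 !mul1r [1]/(dmon set0).
  by rewrite euler_contract_dmon big_set0 mul0r add0r.
rewrite big_cons -mulrA euler_contract_dvarM IH euler_contract_dvarM.
rewrite mulrBl mulrDr opprD addrA; congr (_ - _ + _); rewrite ?mulrA //.
by rewrite exprS mulN1r -!mulrA mulNr sp_signCA.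
Qed.

End Ring.

Definition ideal_gen (A : nzRingType) (X : A -> Prop) : {pred A} :=
  fun u => `[< exists s : seq (A * A * A),
    (forall t, t \in s -> X t.1.2) /\ u = \sum_(t <- s) t.1.1 * t.1.2 * t.2 >].

Section IdealGen.
Variables (A : nzRingType) (X : A -> Prop).

Lemma ideal_genP u : reflect (exists s : seq (A * A * A),
    (forall t, t \in s -> X t.1.2) /\ u = \sum_(t <- s) t.1.1 * t.1.2 * t.2)
  (u \in ideal_gen X).
Proof. exact: asboolP. Qed.

Fact ideal_gen_zmod_closed : zmod_closed (ideal_gen X).
Proof.
split=> [|u v /ideal_genP[s [sX ->]] /ideal_genP[t [tX ->]]].
  by apply/ideal_genP; exists [::]; split=> //; rewrite big_nil.
apply/ideal_genP; exists (s ++ [seq (- x.1.1, x.1.2, x.2) | x <- t]); split.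
  move=> x; rewrite mem_cat => /orP[/sX //|/mapP[y /tX yX ->]]; exact: yX.
rewrite big_cat big_map -sumrN; congr (_ + _).
by apply: eq_bigr => x _; rewrite !mulNr.
Qed.

HB.instance Definition _ :=
  GRing.isZmodClosed.Build A (ideal_gen X) ideal_gen_zmod_closed.

End IdealGen.

Section DiffIdeal.
Variables (K : comNzRingType) (r : nat).

Definition diff_gens k (f : 'I_k -> {mpoly K[r]}) (u : superspace K r) : Prop :=
  exists i, u = sp_poly (f i) \/ u = ext_deriv (sp_poly (f i)).

Definition diff_ideal k (f : 'I_k -> {mpoly K[r]}) : zmodClosed (superspace K r) :=
  ideal_gen (diff_gens f).

Section Quotient.
Variable I : zmodClosed (superspace K r).

Definition quot_pi (u : superspace K r) : {ideal_quot I} :=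
  (\pi_({ideal_quot I}) u)%qT.

(* Independent of the chosen representative as soon as I is stable under       *)
(* ext_deriv.                                                                  *)
Definition quot_deriv (x : {ideal_quot I}) : {ideal_quot I} :=
  quot_pi (ext_deriv (repr x)).

Definition quot_bidegree (a b : int) (x : {ideal_quot I}) : Prop :=
  exists2 u, bidegree a b u & x = quot_pi u.

Definition quot_exact (a b : int) : Prop :=
  forall x : {ideal_quot I}, (quot_bidegree a b x /\ quot_deriv x = 0) <->
    (exists2 y, quot_bidegree (a + 1) (b - 1) y & x = quot_deriv y).

End Quotient.
End DiffIdeal.

(* Main.v *)
(* The Lie derivative d iota + iota d along the Euler field is multiplication  *)
(* by a + b in bidegree (a, b). Both d and iota are antiderivations, so their  *)
(* stability on I is checked on generators, where the only nontrivial case is  *)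
(* Euler's identity iota (d f) = (deg f) f. Hence (a + b)^-1 iota is a         *)
(* contracting homotopy of Psi_L / I whenever a + b <> 0.                      *)
Require Import Defs.
From HB Require Import structures.
From mathcomp Require Import all_boot all_order all_algebra.
From mathcomp Require Import boolp reals complex.
From mathcomp Require Import mpoly.

Set Implicit Arguments.
Unset Strict Implicit.
Unset Printing Implicit Defensive.

Import Order.TTheory GRing.Theory Num.Theory.
Local Open Scope ring_scope.

(** Cartan's formula drives everything: [ext_deriv] and [euler_contract] are antiderivations, so
    their anticommutator [lie_euler] is an ordinary derivation. It acts on functions as the Euler
    operator and fixes each [dvar], hence is the scalar [a + b] in bidegree [(a, b)]
    ([lie_euler_bidegree]). An antiderivation preserves an ideal as soon as it sends homogeneous
    generators into it ([ideal_gen_deriv]). Here d sends f to df and df to 0, while the contraction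
    sends f to 0 and df to (deg f) f. Both operators therefore descend to the quotient. In
    characteristic 0, if du lies in the ideal and [a + b] is nonzero, the contraction of u divided
    by [a + b] is a primitive of u modulo the ideal. The remaining bidegrees other than [(0, 0)]
    have a negative entry and vanish. *)

Section Superspace.
Variables (K : comNzRingType) (r : nat).
Implicit Types (u v w : superspace K r) (S T : {set 'I_r}) (p q : {mpoly K[r]}).
Implicit Types i j : 'I_r.

(** * Anticommutative degree and the sign rule *)

Definition anti_homog (b : nat) u := forall S, u S != 0 -> #|S| = b.

Lemma anti_homog_term b p S : #|S| = b -> anti_homog b (sp_poly p * dmon K S).
Proof.
by move=> cS T; rewrite sp_poly_dmon ffunE; have [->|_] := eqVneq T S; rewrite ?eqxx.
Qed.

Lemma anti_homog_poly p : anti_homog 0 (sp_poly p).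
Proof. by rewrite -[sp_poly p]mulr1; apply: anti_homog_term; rewrite cards0. Qed.

Lemma anti_homog_dvar i : anti_homog 1 (dvar K i).
Proof.
by rewrite -[dvar K i]mul1r -sp_poly1; apply: anti_homog_term; rewrite cards1.
Qed.

Lemma anti_homog_sum b (I : Type) (s : seq I) (F : I -> superspace K r) :
  (forall x, anti_homog b (F x)) -> anti_homog b (\sum_(x <- s) F x).
Proof.
move=> hF S; apply: contra_neq_eq => nS; rewrite sum_ffunE big1 // => i _.
by apply: contra_neq_eq nS => /hF.
Qed.

Lemma anti_homog_polyM b p u : anti_homog b u -> anti_homog b (sp_poly p * u).
Proof.
move=> hu S; rewrite sp_polyMl => nz; apply: hu.
by apply: contraNneq nz => ->; rewrite mulr0.
Qed.

(** Moving a one-form past a term p de_S costs one sign for each of the factors of de_S; this is the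
    source of the sign in the Leibniz rule for d. *)
Lemma dvar_signC b i u : anti_homog b u ->
  dvar K i * u = (-1) ^+ b * (u * dvar K i).
Proof.
move=> hu; rewrite [u]sp_decomp mulr_suml !mulr_sumr; apply: eq_bigr => S _.
have [->|/hu <-] := eqVneq (u S) 0; first by rewrite sp_poly0 !(mul0r, mulr0).
rewrite sp_polyCA -(mulrA (sp_poly _)) -sp_signCA; congr (_ * _).
rewrite dmonE cardE; elim: (enum S) => [|j s IH].
  by rewrite big_nil !mulr1 !mul1r.
rewrite big_cons mulrA dvar_anticomm mulNr -(mulrA _ (dvar K i)) IH exprS mulN1r mulNr.
by rewrite -(mulrA (dvar K j)) (sp_signCA (size s) (dvar K j)).
Qed.

(** * The exterior derivative: Leibniz rule and square zero *)

Definition pderiv (j : 'I_r) u : superspace K r := [ffun S => (u S)^`M(j)].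

Lemma pderivM j u v : pderiv j (u * v) = pderiv j u * v + u * pderiv j v.
Proof.
apply/ffunP => S; rewrite !ffunE raddf_sum -big_split /=; apply: eq_bigr => T _.
rewrite !ffunE -mulrDr -mderivM -signr_odd.
by case: (odd _); rewrite ?(mul1r, mulN1r) //= mderivN.
Qed.

Lemma pderiv_poly j p : pderiv j (sp_poly p) = sp_poly p^`M(j).
Proof. by apply/ffunP => S; rewrite !ffunE; case: ifP => //; rewrite mderiv0. Qed.

Lemma pderivC i j u : pderiv i (pderiv j u) = pderiv j (pderiv i u).
Proof. by apply/ffunP => S; rewrite !ffunE mderiv_comm. Qed.

(** This form separates d into commuting even derivations, which act on coefficients only, and
    anticommuting left multiplications by de_j. Both the Leibniz rule and d^2 = 0 are read off from
    it. *)
Lemma ext_deriv_pderiv u : ext_deriv u = \sum_j dvar K j * pderiv j u.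
Proof.
rewrite /ext_deriv exchange_big; apply: eq_bigr => j _ /=.
rewrite [pderiv j u]sp_decomp mulr_sumr; apply: eq_bigr => S _.
by rewrite sp_polyCA ffunE.
Qed.

Lemma ext_deriv_poly p : ext_deriv (sp_poly p) = \sum_j sp_poly p^`M(j) * dvar K j.
Proof.
by rewrite ext_deriv_pderiv; apply: eq_bigr => j _; rewrite pderiv_poly sp_polyC.
Qed.

Lemma ext_deriv_const (c : K) : ext_deriv (sp_poly c%:MP_[r]) = 0.
Proof. by rewrite ext_deriv_poly big1 // => i _; rewrite mderivC sp_poly0 mul0r. Qed.

Lemma ext_derivM b u v : anti_homog b u ->
  ext_deriv (u * v) = ext_deriv u * v + (-1) ^+ b * (u * ext_deriv v).
Proof.
move=> hu; rewrite !ext_deriv_pderiv mulr_suml !mulr_sumr -big_split /=.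
apply: eq_bigr => j _; rewrite pderivM mulrDr mulrA; congr (_ + _).
by rewrite mulrA (dvar_signC _ hu) !mulrA.
Qed.

Lemma pderiv_dvar i j : pderiv i (dvar K j) = 0.
Proof.
by apply/ffunP => S; rewrite !ffunE; case: ifP; rewrite ?mderiv0 ?(mderivC _ 1).
Qed.

Lemma ext_deriv_dvar i : ext_deriv (dvar K i) = 0.
Proof. by rewrite ext_deriv_pderiv big1 // => j _; rewrite pderiv_dvar mulr0. Qed.

Lemma ext_deriv_dvarM i v : ext_deriv (dvar K i * v) = - (dvar K i * ext_deriv v).
Proof.
by rewrite (ext_derivM _ (@anti_homog_dvar i)) ext_deriv_dvar mul0r add0r mulN1r.
Qed.

Lemma ext_deriv_polyM p v :
  ext_deriv (sp_poly p * v) = ext_deriv (sp_poly p) * v + sp_poly p * ext_deriv v.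
Proof. by rewrite (ext_derivM _ (@anti_homog_poly p)) mul1r. Qed.

Lemma ext_deriv_X i : ext_deriv (sp_poly 'X_i) = dvar K i.
Proof.
rewrite ext_deriv_poly (bigD1 i) //= big1 => [|j nij]; last first.
  by rewrite mderivX mnm1E eq_sym (negPf nij) scale0r sp_poly0 mul0r.
rewrite mderivX mnm1E eqxx scale1r.
have -> : (U_(i) - U_(i))%MM = 0%MM :> 'X_{1..r}.
  by apply/mnmP => j; rewrite mnmBE subnn mnm0E.
by rewrite mpolyX0 sp_poly1 mul1r addr0.
Qed.

(** Mixed partial derivatives are symmetric in the two indices while products of one-forms are
    antisymmetric, so the terms of the double sum cancel. *)
Lemma ext_deriv_sqr u : ext_deriv (ext_deriv u) = 0.
Proof.
rewrite ext_deriv_pderiv [in LHS]ext_deriv_pderiv.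
pose F i j := dvar K i * (dvar K j * pderiv i (pderiv j u)).
have pderiv_dvarM i j w : pderiv i (dvar K j * w) = dvar K j * pderiv i w.
  by rewrite pderivM pderiv_dvar mul0r add0r.
have FN i j : F j i = - F i j.
  by rewrite /F !mulrA (dvar_anticomm K j) mulNr pderivC.
have F0 i : F i i = 0 by rewrite /F mulrA dvar_sqr mul0r.
transitivity (\sum_i \sum_j F i j).
  apply: eq_bigr => i _; rewrite -mulr_sumr; congr (_ * _).
  rewrite -[LHS]/(pderiv i (\sum_j dvar K j * pderiv j u)).
  have -> (G : 'I_r -> superspace K r) : pderiv i (\sum_j G j) = \sum_j pderiv i (G j).
    apply/ffunP => S; rewrite ffunE !sum_ffunE raddf_sum.
    by apply: eq_bigr => j _; rewrite ffunE.
  by apply: eq_bigr => j _; rewrite pderiv_dvarM.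
(* The pairs [i < j] and [j < i] are matched explicitly: over a general ring, a sum equal to its own
   opposite need not vanish, as 2 may be a zero divisor. *)
transitivity (\sum_(i < r)
    (\sum_(j < r | (i < j)%N) F i j + \sum_(j < r | (j < i)%N) F i j)).
  apply: eq_bigr => i _; rewrite (bigID (fun j : 'I_r => (i < j)%N)) /=; congr (_ + _).
  rewrite (bigD1 i) ?ltnn //= F0 add0r; apply: eq_bigl => j.
  by rewrite -leqNgt ltn_neqAle andbC.
rewrite big_split /= [X in _ + X](exchange_big_dep predT) //= -big_split big1 // => i _.
rewrite -big_split big1 //= => j _.
by rewrite (FN i j) subrr.
Qed.

(** * Euler's identity and the Lie derivative along the Euler field *)

Lemma euler_mderiv n p : p \is n.-homog -> \sum_i 'X_i * p^`M(i) = p *+ n.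
Proof.
move=> /dhomogP hp; rewrite [p in RHS]mpolyE -sumrMnl.
transitivity (\sum_(i < r) \sum_(m <- msupp p) 'X_i * (p@_m *: 'X_[m])^`M(i)).
  by apply: eq_bigr => i _; rewrite -mulr_sumr -raddf_sum -mpolyE.
rewrite exchange_big /= big_seq [RHS]big_seq; apply: eq_bigr => m /hp <-.
rewrite /= mdegE -sumrMnr; apply: eq_bigr => i _.
rewrite mderivZ mderivX -!scalerAr scalerA -mpolyXD.
(* Subtraction of exponents is truncated, so a variable absent from the monomial is treated apart;
   its term has coefficient 0. *)
have [z|nz] := eqVneq (m i) 0%N; first by rewrite z mulr0 scale0r mulr0n.
rewrite addmC submK; first by rewrite mulr_natr scalerMnl.
by apply/mnm_lepP => j; rewrite mnm1E; case: eqP => // <-; rewrite lt0n.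
Qed.

Definition lie_euler u := ext_deriv (euler_contract u) + euler_contract (ext_deriv u).

Lemma lie_euler_sum (I : Type) (s : seq I) (F : I -> superspace K r) :
  lie_euler (\sum_(x <- s) F x) = \sum_(x <- s) lie_euler (F x).
Proof.
rewrite /lie_euler (raddf_sum (@euler_contract K r)) !(raddf_sum (@ext_deriv K r)).
by rewrite (raddf_sum (@euler_contract K r)) -big_split.
Qed.

(** The two cross terms with coefficient ['X_i] carry opposite signs and cancel; what is left over
    comes from d e_i = de_i. *)
Lemma lie_euler_dvarM i v :
  lie_euler (dvar K i * v) = dvar K i * v + dvar K i * lie_euler v.
Proof.
rewrite /lie_euler euler_contract_dvarM raddfB /= ext_deriv_dvarM ext_deriv_dvarM.
rewrite (raddfN (@euler_contract K r)) /= euler_contract_dvarM.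
rewrite ext_deriv_polyM ext_deriv_X mulrDr !opprB opprK -!addrA; congr (_ + _).
by rewrite addrC [in LHS]addrA addrNK.
Qed.

Lemma lie_euler_polyM p v : lie_euler (sp_poly p * v) =
  sp_poly (\sum_i 'X_i * p^`M(i)) * v + sp_poly p * lie_euler v.
Proof.
rewrite /lie_euler euler_contractZ !ext_deriv_polyM raddfD /= euler_contractZ.
suff -> : euler_contract (ext_deriv (sp_poly p) * v) =
    sp_poly (\sum_i 'X_i * p^`M(i)) * v - ext_deriv (sp_poly p) * euler_contract v.
  by rewrite mulrDr addrACA [X in X + _ = _]addrC addrNK.
rewrite ext_deriv_poly !mulr_suml (raddf_sum (@euler_contract K r)).
have -> (G : 'I_r -> {mpoly K[r]}) : sp_poly (\sum_i G i) = \sum_i sp_poly (G i).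
  apply/ffunP => S; rewrite sum_ffunE ffunE; under [RHS]eq_bigr => i _ do rewrite ffunE.
  by case: ifP => // _; rewrite big1.
rewrite mulr_suml -sumrB; apply: eq_bigr => i _ /=.
rewrite -mulrA euler_contractZ euler_contract_dvarM mulrBr !mulrA.
by rewrite -sp_polyM [p^`M(i) * _]mulrC.
Qed.

Lemma lie_euler_dmon S : lie_euler (dmon K S) = dmon K S *+ #|S|.
Proof.
rewrite dmonE cardE; elim: (enum S) => [|i s IH]; last first.
  by rewrite big_cons lie_euler_dvarM IH -mulrnAr -mulrDr -mulrS mulrnAr.
rewrite big_nil /lie_euler [X in euler_contract X](_ : 1 = dmon K set0) //.
rewrite euler_contract_dmon big_set0 raddf0 -sp_poly1.
by rewrite (ext_deriv_const 1) raddf0 addr0.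
Qed.

Lemma lie_euler_bidegree (a b : nat) u :
  bidegree a%:Z b%:Z u -> lie_euler u = u *+ (a + b).
Proof.
move=> hu; rewrite {1}[u]sp_decomp lie_euler_sum [u in RHS]sp_decomp -sumrMnl.
apply: eq_bigr => S _; rewrite lie_euler_polyM lie_euler_dmon.
have -> : \sum_i 'X_i * (u S)^`M(i) = u S *+ a.
  apply/euler_mderiv/dhomogP => m; rewrite mcoeff_msupp => /hu[/eqP + _].
  by rewrite eqz_nat => /eqP.
(* A zero coefficient says nothing about the size of [S]; only a nonzero one forces [#|S| = b]. *)
have [->|nz] := eqVneq (u S) 0; first by rewrite mul0rn sp_poly0 !mul0r addr0 mul0rn.
have -> : #|S| = b.
  have [m nm] : exists m, (u S)@_m != 0.
    apply/not_existsP => z; case/eqP: nz; apply/mpolyP => m; rewrite mcoeff0.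
    by apply/eqP; have := z m; case: eqP.
  by have [_ /eqP] := hu _ _ nm; rewrite eqz_nat => /eqP.
rewrite mulrnAr mulrnDr; congr (_ + _).
suff -> : sp_poly (u S *+ a) = sp_poly (u S) *+ a by rewrite mulrnAl.
elim: a {hu} => [|n IH]; first by rewrite !mulr0n sp_poly0.
by rewrite !mulrS -IH; apply/ffunP => T; rewrite !ffunE; case: ifP; rewrite ?addr0.
Qed.

(** * Bidegrees of d and of the contraction *)

Lemma bidegreeD (a b : int) u v :
  bidegree a b u -> bidegree a b v -> bidegree a b (u + v).
Proof.
move=> hu hv S m; rewrite ffunE mcoeffD; have [z|/hu//] := eqVneq (u S)@_m 0.
by rewrite z add0r => /hv.
Qed.

Lemma bidegree0 (a b : int) : bidegree a b (0 : superspace K r).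
Proof. by move=> S m; rewrite ffunE mcoeff0 eqxx. Qed.

Lemma bidegree_sum (a b : int) (I : Type) (s : seq I) (P : pred I)
    (F : I -> superspace K r) :
  (forall x, P x -> bidegree a b (F x)) -> bidegree a b (\sum_(x <- s | P x) F x).
Proof.
by move=> hF; elim/big_ind: _ => //; [exact: bidegree0 | exact: bidegreeD].
Qed.

Lemma bidegree_polyC (a b : int) (c : K) u :
  bidegree a b u -> bidegree a b (sp_poly c%:MP * u).
Proof.
move=> hu S m; rewrite sp_polyMl mcoeffCM => nz; apply: hu.
by apply: contraNneq nz => ->; rewrite mulr0.
Qed.

Lemma bidegree_sign (a b : int) n u : bidegree a b u -> bidegree a b ((-1) ^+ n * u).
Proof.
move=> hu; have := bidegree_polyC (c := (-1) ^+ n) hu.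
by rewrite rmorphXn rmorphN rmorph1 sp_poly_sign.
Qed.

Lemma bidegree_term (a b : int) p S :
  (forall m, p@_m != 0 -> (mdeg m)%:Z = a /\ #|S|%:Z = b) ->
  bidegree a b (sp_poly p * dmon K S).
Proof.
move=> hp T m; rewrite sp_poly_dmon ffunE; have [->|_] := eqVneq T S; first exact: hp.
by rewrite mcoeff0 eqxx.
Qed.

Lemma bidegree_ext_deriv (a b : int) u :
  bidegree a b u -> bidegree (a - 1) (b + 1) (ext_deriv u).
Proof.
move=> hu; apply: bidegree_sum => S _; apply: bidegree_sum => j _.
rewrite dvar_dmon; case: ifPn => jS; first by rewrite mulr0; apply: bidegree0.
rewrite sp_signCA; apply: bidegree_sign; apply: bidegree_term => m.
rewrite mcoeff_mderiv => nz; have [|<- <-] := hu S (m + U_(j))%MM.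
  by apply: contraNneq nz => ->; rewrite mul0rn.
by rewrite mdegD mdeg1 PoszD addrK cardsU1 jS addnC PoszD.
Qed.

Lemma bidegree_euler_contract (a b : int) u :
  bidegree a b u -> bidegree (a + 1) (b - 1) (euler_contract u).
Proof.
move=> hu; apply: bidegree_sum => S _; apply: bidegree_sum => j jS.
apply: bidegree_sign; apply: bidegree_term => m.
rewrite mulrC -mcoeff_msupp (perm_mem (msuppMX _ _)) => /mapP[m' + ->].
rewrite mcoeff_msupp => /hu[<- <-].
by rewrite mdegD mdeg1 addnC PoszD (cardsD1 j S) jS addnC PoszD addrK.
Qed.

Lemma bidegree_lt0 (a b : int) u : (a < 0) || (b < 0) -> bidegree a b u -> u = 0.
Proof.
move=> ab hu; apply/ffunP => S; apply/mpolyP => m; rewrite ffunE mcoeff0.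
apply/eqP; apply: contraTT ab => /hu[<- <-].
by rewrite negb_or -!leNgt.
Qed.

End Superspace.

(** * Two-sided ideals given by generators *)

Section IdealGen.
Variables (A : nzRingType) (X : A -> Prop).

Lemma mem_ideal_gen x : X x -> x \in ideal_gen X.
Proof.
move=> hx; apply/ideal_genP; exists [:: (1, x, 1)]; rewrite big_seq1 mul1r mulr1.
by split=> // t; rewrite inE => /eqP ->.
Qed.

Lemma ideal_genM a b x : x \in ideal_gen X -> a * x * b \in ideal_gen X.
Proof.
case/ideal_genP => s [hs ->]; apply/ideal_genP.
exists [seq (a * t.1.1, t.1.2, t.2 * b) | t <- s]; split.
  by move=> _ /mapP[t /hs ht ->].
by rewrite mulr_sumr mulr_suml big_map; apply: eq_bigr => t _; rewrite !mulrA.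
Qed.

Lemma ideal_genMl a x : x \in ideal_gen X -> a * x \in ideal_gen X.
Proof. by move=> /(ideal_genM a 1); rewrite mulr1. Qed.

Lemma ideal_genMr b x : x \in ideal_gen X -> x * b \in ideal_gen X.
Proof. by move=> /(ideal_genM 1 b); rewrite mul1r. Qed.

End IdealGen.

(** * Stability of the differential ideal and descent to the quotient *)

Section DiffIdeal.
Variables (K : comNzRingType) (r : nat).
Implicit Types u v : superspace K r.

(** The common argument for d and the contraction. The sign in the Leibniz rule depends on the
    degree of the left factor, so generators must be homogeneous and left coefficients are split
    into terms p de_S. *)
Lemma ideal_gen_deriv (D : {additive superspace K r -> superspace K r})
    (X : superspace K r -> Prop) :
  (forall b u v, anti_homog b u -> D (u * v) = D u * v + (-1) ^+ b * (u * D v)) ->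
  (forall g, X g -> (exists b, anti_homog b g) /\ D g \in ideal_gen X) ->
  forall u, u \in ideal_gen X -> D u \in ideal_gen X.
Proof.
move=> DM DX.
have DMr g v : X g -> D (g * v) \in ideal_gen X.
  move=> Xg; have [[b hb] Dg] := DX g Xg; rewrite (DM b) // rpredD //.
    exact: ideal_genMr.
  by apply/ideal_genMl/ideal_genMr/mem_ideal_gen.
move=> _ /ideal_genP[s [sX ->]]; rewrite raddf_sum big_seq rpred_sum // => t /sX Xt /=.
rewrite -mulrA [t.1.1]sp_decomp mulr_suml raddf_sum rpred_sum // => S _ /=.
rewrite (DM #|S|); last exact: anti_homog_term.
rewrite rpredD //; last by do 2!apply: ideal_genMl; apply: DMr.
by apply/ideal_genMl/ideal_genMr/mem_ideal_gen.
Qed.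

Lemma quot_piP (I : zmodClosed (superspace K r)) u v :
  (quot_pi I u = quot_pi I v) <-> (u - v \in I).
Proof.
by rewrite Quotient.idealrBE /quot_pi; split=> /eqP.
Qed.

Lemma quot_pi_eq0 (I : zmodClosed (superspace K r)) u : (quot_pi I u = 0) <-> (u \in I).
Proof.
have <- : quot_pi I 0 = 0 by rewrite /quot_pi raddf0.
by rewrite quot_piP subr0.
Qed.

Variables (k : nat) (f : 'I_k -> {mpoly K[r]}).
Hypothesis hf : forall i, exists n, f i \is n.-homog.

Lemma diff_ideal_ext_deriv u : u \in diff_ideal f -> ext_deriv u \in diff_ideal f.
Proof.
apply: ideal_gen_deriv => [b v w|_ [i [->|->]]]; first exact: ext_derivM.
  split; first by exists 0%N; apply: anti_homog_poly.
  by apply: mem_ideal_gen; exists i; right.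
split; last by rewrite /= ext_deriv_sqr rpred0.
exists 1%N; rewrite ext_deriv_poly; apply: anti_homog_sum => j.
exact/anti_homog_polyM/anti_homog_dvar.
Qed.

Lemma diff_ideal_euler_contract u :
  u \in diff_ideal f -> euler_contract u \in diff_ideal f.
Proof.
have i0 p : euler_contract (sp_poly p) = 0 :> superspace K r.
  rewrite -[sp_poly p]mulr1 euler_contractZ [1](_ : _ = dmon K set0) //.
  by rewrite euler_contract_dmon big_set0 mulr0.
apply: ideal_gen_deriv => [b v w|_ [i [->|->]]]; first exact: euler_contractM.
  by split; [exists 0%N; apply: anti_homog_poly | rewrite /= i0 rpred0].
split.
  exists 1%N; rewrite ext_deriv_poly; apply: anti_homog_sum => j.
  exact/anti_homog_polyM/anti_homog_dvar.
have [n hn] := hf i; rewrite /=.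
(* [f i] has bidegree [(n, 0)] and the contraction kills functions, so the Lie derivative formula
   reduces to this identity. *)
have -> : euler_contract (ext_deriv (sp_poly (f i))) = sp_poly (f i) *+ n.
  rewrite -[n in RHS]addn0 -(lie_euler_bidegree (a := n) (b := 0)) => [|S m].
    by rewrite /lie_euler i0 raddf0 add0r.
  rewrite ffunE; have [->|_] := eqVneq S set0; last by rewrite mcoeff0 eqxx.
  by rewrite -mcoeff_msupp cards0 => /(dhomog_mf hn) ->.
by rewrite rpredMn //; apply: mem_ideal_gen; exists i; left.
Qed.

Lemma quot_derivE u :
  quot_deriv (quot_pi (diff_ideal f) u) = quot_pi (diff_ideal f) (ext_deriv u).
Proof.
apply/quot_piP; rewrite -raddfB; apply: diff_ideal_ext_deriv.
by apply/quot_piP; rewrite /quot_pi reprK.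
Qed.

End DiffIdeal.

(** * Exactness by the contracting homotopy *)

Lemma quot_deriv_exact (K : numFieldType) (r k : nat) (f : 'I_k -> {mpoly K[r]})
    (hf : forall i, exists n, f i \is n.-homog) (a b : int) :
  (a, b) != (0, 0) -> quot_exact (diff_ideal f) a b.
Proof.
move=> ab x; split=> [[[u hu ->]]|[_ [u hu ->] ->]]; last first.
  rewrite !quot_derivE; split; last by rewrite ext_deriv_sqr; apply/quot_pi_eq0/rpred0.
  exists (ext_deriv u) => //.
  by have := bidegree_ext_deriv hu; rewrite addrK subrK.
rewrite quot_derivE => /quot_pi_eq0 du.
(* Degrees range over all integers. With a negative entry [u] is 0, so 0 is a primitive; otherwise
   [a + b] is a positive natural number. *)
have [lt0|] := boolP ((a < 0) || (b < 0)).
  exists (quot_pi _ 0); first by exists 0 => //; apply: bidegree0.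
  by rewrite quot_derivE raddf0 (bidegree_lt0 lt0 hu).
rewrite negb_or -!leNgt => /andP[]; case: a b => [a|//] [b|//] in ab hu * => _ _.
have n0 : (a + b)%:R != 0 :> K.
  by rewrite pnatr_eq0; apply: contra ab; rewrite addn_eq0 => /andP[/eqP -> /eqP ->].
pose c := sp_poly (r := r) ((a + b)%:R^-1%:MP : {mpoly K[r]}).
have cK v : c * (v *+ (a + b)) = v.
  apply/ffunP => S; rewrite sp_polyMl ffunMnE mul_mpolyC -scaler_nat scalerA.
  by rewrite mulVf // scale1r.
exists (quot_pi _ (c * euler_contract u)).
  by exists (c * euler_contract u) => //; apply/bidegree_polyC/bidegree_euler_contract.
rewrite quot_derivE; apply/quot_piP.
(* Write [u] as [c * lie_euler u]. Since [c] is constant, d of the proposed primitive cancels one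
   half of the Lie derivative, leaving [c] times the contraction of du, which is in the ideal by
   [du] and stability. *)
rewrite -{1}[u]cK -(lie_euler_bidegree hu) ext_deriv_polyM.
rewrite ext_deriv_const mul0r add0r -mulrBr /lie_euler addrC addKr.
exact/ideal_genMl/diff_ideal_euler_contract.
Qed.

Theorem lemma4p6 (R : realType) (r k : nat) (f : 'I_k -> {mpoly R[i][r]})
    (hf : forall i : 'I_k, exists n : nat, f i \is n.-homog) :
  [/\ forall u, u \in diff_ideal f -> ext_deriv u \in diff_ideal f,
      forall u, u \in diff_ideal f -> euler_contract u \in diff_ideal f,
      forall u, quot_deriv (quot_pi (diff_ideal f) u) =
                quot_pi (diff_ideal f) (ext_deriv u)
    & forall a b : int, (a, b) != (0, 0) -> quot_exact (diff_ideal f) a b].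
Proof.
split=> [u|u|u|a b].
- exact: diff_ideal_ext_deriv.
- exact: diff_ideal_euler_contract.
- exact: quot_derivE.
- exact: quot_deriv_exact.
Qed.
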